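(* Let $\Gamma:=N\rtimes G$ be a semidirect product group and let $\Gamma_0$ be a subgroup of $N$. Suppose that $S$ is a subsemigroup of $G$ such that $S^{-1}S=G$ and $s^{-1}\Gamma_0 s\subset\Gamma_0$ for every $s\in S$. Then $(\Gamma,\Gamma_0)$ is a Hecke pair if and only if $(N,\Gamma_0)$ is a Hecke pair and $|s^{-1}\Gamma_0 s\backslash\Gamma_0|<\infty$ for every $s\in S$. Furthermore, $R(s)=|s^{-1}\Gamma_0 s\backslash\Gamma_0|$ for every $s\in S$, and (when these are Hecke pairs) the identity map gives an embedding of unital $*$-algebras $\mathcal H(N,\Gamma_0)\hookrightarrow\mathcal H(\Gamma,\Gamma_0)$.
   Context: A group--subgroup pair $(\Gamma,\Gamma_0)$ is a Hecke pair if every double coset $\Gamma_0\gamma\Gamma_0$ is a finite union of left cosets $\gamma_i\Gamma_0$ (equivalently, every double coset is a finite union of right cosets $\Gamma_0\gamma_i$). The Hecke $*$-algebra $\mathcal H(\Gamma,\Gamma_0)$ is the vector space of $\Gamma_0$-biinvariant functions $\Gamma\to\mathbb C$ supported on finitely many double cosets, with product $(f*g)(\gamma)=\sum_{\gamma_1\in\Gamma_0\backslash\Gamma}f(\gamma\gamma_1^{-1})g(\gamma_1)$ and involution $f^*(\gamma)=\overline{f(\gamma^{-1})}$; its unit is the characteristic function of $\Gamma_0$. $[\gamma]$ denotes the characteristic function of $\Gamma_0\gamma\Gamma_0$. $R(\gamma)$ is the number of right cosets $\Gamma_0\delta$ contained in $\Gamma_0\gamma\Gamma_0$. If $G$ acts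 on $N$ by automorphisms $\psi_g$, then $N\rtimes G$ is the set $N\times G$ with product $(n,g)(m,h)=(n\psi_g(m),gh)$; $N$ (normal) and $G$ are viewed as subgroups of $\Gamma$, and $\psi_g(m)=gmg^{-1}$. $S^{-1}S=\{t^{-1}s: s,t\in S\}$. The identity map $\mathcal H(N,\Gamma_0)\to\mathcal H(\Gamma,\Gamma_0)$ sends $[x]$ to $[x]$ for $x\in N$, i.e. it extends functions on $N$ by zero to $\Gamma$. *)

(* Defs.v *)
From HB Require Import structures.
From mathcomp Require Import all_boot all_order all_algebra.
From mathcomp Require Import monoid.
From mathcomp Require Import boolp classical_sets functions cardinality fsbigop.
From mathcomp Require Import reals complex.

Set Implicit Arguments.
Unset Strict Implicit.
Unset Printing Implicit Defensive.

Import GRing.Theory Num.Theory.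

Local Open Scope classical_set_scope.
Local Open Scope group_scope.

(* An action of G on N by automorphisms; each [act g] is bijective, with
   inverse [act g^-1]. *)
Record aut_action (G N : groupType) := AutAction {
  act :> G -> {multiplicative N -> N};
  act1 : forall n, act 1 n = n;
  actM : forall g h n, act (g * h) n = act g (act h n)
}.

Definition semidirect (N G : groupType) (psi : aut_action G N) : Type :=
  (N * G)%type.

Section SemidirectGroup.
Context (N G : groupType) (psi : aut_action G N).
Local Notation T := (semidirect psi).

HB.instance Definition _ := Choice.copy T (N * G)%type.

Definition sd_mul (x y : T) : T := (x.1 * psi x.2 y.1, x.2 * y.2).
Definition sd_one : T := (1, 1).
Definition sd_inv (x : T) : T := (psi x.2^-1 x.1^-1, x.2^-1).

Lemma sd_mulA : associative sd_mul.
Proof. by move=> x y z; rewrite /sd_mul /= !gmulfM actM !mulgA. Qed.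

Lemma act_one g : psi g 1 = 1.
Proof. by apply: (mulgI (psi g 1)); rewrite -gmulfM !mulg1. Qed.

Lemma sd_mul1 : left_id sd_one sd_mul.
Proof. by case=> n g; rewrite /sd_mul /= act1 !mul1g. Qed.

Lemma sd_mulr1 : right_id sd_one sd_mul.
Proof. by case=> n g; rewrite /sd_mul /= act_one !mulg1. Qed.

Lemma sd_mulV : left_inverse sd_one sd_inv sd_mul.
Proof. by case=> n g; rewrite /sd_mul /= -gmulfM !mulVg act_one. Qed.

Lemma sd_mulrV : right_inverse sd_one sd_inv sd_mul.
Proof. by case=> n g; rewrite /sd_mul /= -actM !mulgV act1 mulgV. Qed.

HB.instance Definition _ :=
  isGroup.Build T sd_mulA sd_mul1 sd_mulr1 sd_mulV sd_mulrV.

Definition inN (n : N) : T := (n, 1).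
Definition inG (g : G) : T := (1, g).

End SemidirectGroup.

Arguments inN {N G} psi n.
Arguments inG {N G} psi g.

Section Hecke.
Context {T : groupType}.
Implicit Types (H K D : set T) (x : T).

Definition left_coset x H : set T := [set x * h | h in H].
Definition right_coset H x : set T := [set h * x | h in H].
Definition double_coset H x : set T := [set h * x * k | h in H & k in H].
Definition conj_set H x : set T := [set h ^ x | h in H].

(* H \ D, the set of right cosets H x with x in D; when H is a subgroup and
   H D = D these are exactly the right cosets of H contained in D. *)
Definition right_cosets H D : set (set T) := [set right_coset H x | x in D].

Definition hecke_pair H : Prop :=
  forall x, exists2 A : set T, finite_set A &
    double_coset H x = \bigcup_(a in A) left_coset a H.

(* The right cosets H y contained in H x H; the number R(x) is the cardinality
   of this set. *)
Definition R_cosets H x : set (set T) :=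
  [set c | (exists y, c = right_coset H y) /\ c `<=` double_coset H x].

Context {R : realType}.
Local Notation C := (R[i]).
Implicit Types f g : T -> C.

Definition hecke_algebra H : set (T -> C) :=
  [set f | (forall h k x, H h -> H k -> f (h * x * k) = f x) /\
           finite_set [set double_coset H x | x in [set x | f x != 0%R]]].

(* Each right coset c in H \ T is evaluated at a chosen representative
   [xget 1 c]; for biinvariant f and g the summand does not depend on it. For a
   Hecke pair the summands are nonzero for finitely many c only. *)
Definition hecke_mul H f g : T -> C := fun x =>
  (\sum_(c \in right_cosets H setT)
     f (x * (xget 1%g c)^-1)%g * g (xget 1%g c))%R.

Definition hecke_star f : T -> C := fun x => Num.conj (f x^-1).

Definition hecke_one H : T -> C := fun x => ((x \in H)%:R)%R.

End Hecke.

(* phi restricts to an injective homomorphism of unital *-algebras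
   H(T, H) -> H(U, K). *)
Definition hecke_embedding {R : realType} {T U : groupType}
    (H : set T) (K : set U) (phi : (T -> R[i]) -> (U -> R[i])) : Prop :=
  [/\ {homo phi : f / hecke_algebra H f >-> hecke_algebra K f},
      {in hecke_algebra H &, injective phi},
      {in hecke_algebra H &, forall f g (a : R[i]),
         phi (a \*o f \+ g)%R = (a \*o phi f \+ phi g)%R},
      {in hecke_algebra H &, forall f g,
         phi (hecke_mul H f g) = hecke_mul K (phi f) (phi g)} &
      {in hecke_algebra H, forall f,
         phi (hecke_star f) = hecke_star (phi f)} /\
      phi (hecke_one H) = hecke_one K].

Definition extend_by_zero {R : realType} {N G : groupType}
    (psi : aut_action G N) (f : N -> R[i]) : semidirect psi -> R[i] :=
  fun x => if x.2 == 1 then f x.1 else 0%R.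

(* Main.v *)
Require Import Defs.
From HB Require Import structures.
From mathcomp Require Import all_boot all_order all_algebra.
From mathcomp Require Import monoid.
From mathcomp Require Import boolp classical_sets functions cardinality fsbigop.
From mathcomp Require Import reals complex.

(** Write [H] for the image [Gamma0] of [N0] in the semidirect product.  The
    Hecke condition can be tested one element at a time: call [x] left-finite
    when [H x H] lies in finitely many left cosets of [H].  Left-finite elements
    are closed under products ([left_finiteM]), so it suffices to control
    generators.  Because G = S^-1 S, each element of the semidirect product
    factors as [(n, 1) * (1, t)^-1 * (1, s)] with [s], [t] in [S], and the three
    factors are left-finite for different reasons:
    - [(n, 1)] is left-finite exactly when [n] is so for [N0], since the double
      coset stays inside [N] ([left_finite_inN]);
    - [(1, s)] always is, since [H^s <= H] gives [H s H = s H], where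
      [H^s = s^-1 H s] ([left_finite_conj_sub]);
    - inversion turns the left cosets in [H t^-1 H] into the right cosets in
      [H t H] ([left_finiteV]), and left translation by [t] matches these with
      the cosets of [H^t] in [H] ([card_R_cosets]).  So [(1, t)^-1] is
      left-finite exactly when the index of [H^t] in [H] is finite.
    The first and third items also give the converse, and the translation by [t]
    gives the formula for [R(t)].

    For the Hecke algebras, the one substantial point is the product.  In
    the sum defining the product of two functions extended by zero, only the
    cosets [H r] with [r] in [N] contribute; these correspond bijectively to the
    cosets of [N0] in [N], and biinvariance makes the summands independent of
    the representatives chosen on each side ([extend_hecke_mul]).  If the point
    at which the product is evaluated is outside [N], then either its quotient
    by [r] or [r] itself is outside [N], so every summand vanishes. *)

Set Implicit Arguments.
Unset Strict Implicit.
Unset Printing Implicit Defensive.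

Import GRing.Theory.

Local Open Scope classical_set_scope.
Local Open Scope group_scope.
Local Open Scope card_scope.

(** * Subgroups and their cosets *)

Lemma inj_image {aT rT : Type} (f : aT -> rT) (A B : set aT) :
  injective f -> f @` A = f @` B -> A = B.
Proof.
by move=> fI AB; apply/funext => a; rewrite -(image_inj fI) AB image_inj.
Qed.

Lemma subgroup1 {T : groupType} (H : set T) : group_closed [in H] -> H 1.
Proof. by case=> /set_mem. Qed.

Lemma subgroupV {T : groupType} (H : set T) (x : T) :
  group_closed [in H] -> H x -> H x^-1.
Proof.
case=> H1 HD Hx; have := HD 1 x H1 (mem_set Hx).
by rewrite mul1g => /set_mem.
Qed.

Lemma subgroupM {T : groupType} (H : set T) (x y : T) :
  group_closed [in H] -> H x -> H y -> H (x * y).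
Proof.
move=> gH Hx Hy; have := gH.2 x y^-1 (mem_set Hx) (mem_set (subgroupV gH Hy)).
by rewrite invgK => /set_mem.
Qed.

Lemma right_coset_eq {T : groupType} (H : set T) (x y : T) :
  group_closed [in H] -> right_coset H x y -> right_coset H y = right_coset H x.
Proof.
move=> gH [h Hh <-]; apply/seteqP; split=> _ [k Hk <-].
  by exists (k * h); [exact: subgroupM | rewrite mulgA].
exists (k * h^-1); first by apply: subgroupM => //; apply: subgroupV.
by rewrite mulgA mulgVK.
Qed.

Lemma right_coset_refl {T : groupType} (H : set T) (x : T) :
  group_closed [in H] -> right_coset H x x.
Proof. by move=> gH; exists 1; [exact: subgroup1 | rewrite mul1g]. Qed.

(** The representatives chosen in the definition of the Hecke product do lie
    in their cosets. *)
Lemma right_coset_xget {T : groupType} (H : set T) (x : T) :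
  group_closed [in H] -> right_coset H x (xget 1 (right_coset H x)).
Proof. by move=> gH; apply: xgetPex; exists x; exact: right_coset_refl. Qed.

(** * Left-finite elements *)

(** Only an inclusion is asked for, so that covers can be multiplied and
    transported without discarding superfluous cosets. *)
Definition left_finite {T : groupType} (H : set T) (x : T) : Prop :=
  exists2 A : set T, finite_set A &
    double_coset H x `<=` \bigcup_(a in A) left_coset a H.

(** A left coset of [H] that meets [H x H] is contained in it; hence a finite
    cover by left cosets becomes an equality once the cosets not contained in
    [H x H] are dropped. *)
Lemma hecke_pairE {T : groupType} (H : set T) :
  group_closed [in H] -> hecke_pair H <-> forall x, left_finite H x.
Proof.
move=> gH; split=> [hH x|lH x].
  by have [A fA xA] := hH x; exists A => //; rewrite xA.
have [A fA sA] := lH x.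
exists (A `&` [set a | left_coset a H `<=` double_coset H x]).
  by apply: finite_setI; left.
apply/seteqP; split=> [z xz|z [a [_ sa] az]]; last exact: sa.
have [a Aa [k Hk kz]] := sA z xz; exists a; last by exists k.
split=> // _ [k' Hk' <-]; case: xz => h Hh [l Hl lz].
exists h => //; exists (l * (k^-1 * k')).
  by apply: subgroupM => //; apply: subgroupM => //; apply: subgroupV.
by rewrite mulgA lz -kz mulgA mulgK.
Qed.

(** [H x y H] is contained in [(H x H) y H], and each of the finitely many
    cosets [a H] covering [H x H] contributes [a (H y H)]. *)
Lemma left_finiteM {T : groupType} (H : set T) (x y : T) :
  group_closed [in H] -> left_finite H x -> left_finite H y ->
  left_finite H (x * y).
Proof.
move=> gH [A fA sA] [B fB sB].
exists [set a * b | a in A & b in B]; first exact: finite_image2.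
move=> _ [h Hh [k Hk <-]].
have [a Aa [l Hl al]] : (\bigcup_(a in A) left_coset a H) (h * x * 1).
  by apply: sA; exists h => //; exists 1 => //; exact: subgroup1.
have [b Bb [m Hm bm]] : (\bigcup_(b in B) left_coset b H) (l * y * k).
  by apply: sB; exists l => //; exists k.
exists (a * b); first by exists a => //; exists b.
exists m => //; rewrite -mulgA bm.
by rewrite (mulgA h) -[h * x]mulg1 -al !mulgA.
Qed.

(** The hypothesis says [H s <= s H], whence [H s H = s H]. *)
Lemma left_finite_conj_sub {T : groupType} (H : set T) (s : T) :
  group_closed [in H] -> conj_set H s `<=` H -> left_finite H s.
Proof.
move=> gH sH; exists [set s]; first exact: finite_set1.
move=> _ [h Hh [k Hk <-]]; exists s => //.
exists (h ^ s * k); first by apply: subgroupM => //; apply: sH; exists h.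
by rewrite conjgE !mulgA mulgV mul1g.
Qed.

(** Inversion exchanges [H x H] with [H x^-1 H] and right cosets with left
    cosets. *)
Lemma left_finiteV {T : groupType} (H : set T) (x : T) :
  group_closed [in H] -> left_finite H x^-1 <-> finite_set (R_cosets H x).
Proof.
move=> gH; split=> [[A fA sA]|fR].
  apply: (@sub_finite_set _ _ [set right_coset H a^-1 | a in A]);
    last exact: finite_image.
  move=> _ [[y ->] /(_ y (right_coset_refl _ gH)) [h Hh [k Hk kxh]]].
  have [a Aa [l Hl al]] : (\bigcup_(a in A) left_coset a H) y^-1.
    apply: sA; exists k^-1; first exact: subgroupV.
    exists h^-1; first exact: subgroupV.
    by rewrite -kxh !invgM !mulgA.
  exists a => //; apply/esym/right_coset_eq => //.
  exists l^-1; first exact: subgroupV.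
  by rewrite -invgM al invgK.
exists [set (xget 1 c)^-1 | c in R_cosets H x]; first exact: finite_image.
move=> _ [h Hh [k Hk <-]]; set z := h * x^-1 * k.
exists (xget 1 (right_coset H z^-1))^-1.
  exists (right_coset H z^-1) => //; split; first by exists z^-1.
  move=> _ [l Hl <-]; exists (l * k^-1).
    by apply: subgroupM => //; apply: subgroupV.
  exists h^-1; first exact: subgroupV.
  by rewrite /z !invgM invgK !mulgA.
have [l Hl lz] := right_coset_xget z^-1 gH.
by exists l => //; rewrite -lz invgM invgK mulgVK.
Qed.

(** Left translation by [x] sends [H^x h] to [H x h], and the right cosets in
    [H x H] are precisely the [H x h] with [h] in [H]. *)
Lemma card_R_cosets {T : groupType} (H : set T) (x : T) :
  group_closed [in H] -> R_cosets H x #= right_cosets (conj_set H x) H.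
Proof.
move=> gH; pose tr (c : set T) := [set x * u | u in c].
have tr_conj h : tr (right_coset (conj_set H x) h) = right_coset H (x * h).
  apply/seteqP; split=> [_ [_ [_ [k Hk <-] <-] <-]|_ [k Hk <-]].
    by exists k => //; rewrite conjgE !mulgA mulgV mul1g.
  exists (k ^ x * h); last by rewrite conjgE !mulgA mulgV mul1g.
  by exists (k ^ x) => //; exists k.
have -> : R_cosets H x = tr @` right_cosets (conj_set H x) H.
  apply/seteqP; split=> [_ [[y ->] sy]|_ [_ [h Hh <-] <-]].
    have [h Hh [k Hk hk]] := sy y (right_coset_refl y gH).
    exists (right_coset (conj_set H x) k); first by exists k.
    rewrite tr_conj; apply/esym/right_coset_eq => //.
    by exists h => //; rewrite mulgA.
  rewrite tr_conj; split; first by exists (x * h).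
  by move=> _ [k Hk <-]; exists k => //; exists h => //; rewrite mulgA.
apply: inj_card_eq => c d _ _; exact: inj_image (@mulgI _ x).
Qed.

(** * The normal factor of a semidirect product *)

Lemma inN_inj {N G : groupType} (psi : aut_action G N) : injective (inN psi).
Proof. by move=> n m []. Qed.

Lemma inNM {N G : groupType} (psi : aut_action G N) (n m : N) :
  inN psi (n * m) = inN psi n * inN psi m.
Proof. by congr pair; rewrite /= ?act1 ?mulg1. Qed.

Lemma inNV {N G : groupType} (psi : aut_action G N) (n : N) :
  inN psi n^-1 = (inN psi n)^-1.
Proof. by congr pair; rewrite /= ?invg1 ?act1. Qed.

Lemma group_closed_inN {N G : groupType} (psi : aut_action G N) (H : set N) :
  group_closed [in H] -> group_closed [in inN psi @` H].
Proof.
move=> gH; split; first by apply/mem_set; exists 1; first exact: subgroup1.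
move=> _ _ /set_mem[n Hn <-] /set_mem[m Hm <-]; apply/mem_set.
exists (n * m^-1); last by rewrite inNM inNV.
by apply: subgroupM => //; apply: subgroupV.
Qed.

Lemma double_coset_inN {N G : groupType} (psi : aut_action G N) (H : set N)
    (n : N) :
  double_coset (inN psi @` H) (inN psi n) = inN psi @` double_coset H n.
Proof.
apply/seteqP; split.
  move=> _ [_ [h Hh <-] [_ [k Hk <-] <-]].
  by exists (h * n * k); [exists h => //; exists k | rewrite !inNM].
move=> _ [_ [h Hh [k Hk <-]] <-]; exists (inN psi h); first by exists h.
by exists (inN psi k); [exists k | rewrite !inNM].
Qed.

Lemma right_coset_inN {N G : groupType} (psi : aut_action G N) (H : set N)
    (n : N) :
  right_coset (inN psi @` H) (inN psi n) = inN psi @` right_coset H n.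
Proof.
apply/seteqP; split=> [_ [_ [h Hh <-] <-]|_ [_ [h Hh <-] <-]].
  by exists (h * n); [exists h | rewrite inNM].
by exists (inN psi h); [exists h | rewrite inNM].
Qed.

(** A left coset of [inN H] that meets [N] has its representative in [N], so a
    cover in the semidirect product projects to a cover in [N]. *)
Lemma left_finite_inN {N G : groupType} (psi : aut_action G N) (H : set N)
    (n : N) :
  left_finite (inN psi @` H) (inN psi n) <-> left_finite H n.
Proof.
rewrite /left_finite double_coset_inN; split=> -[A fA sA].
  exists (fst @` A); first exact: finite_image.
  move=> m nm; have [a Aa [_ [h Hh <-] ah]] := sA _ (imageP (inN psi) nm).
  exists a.1; first by exists a.
  exists h => //; case: a ah {Aa} => a g /= [<-] g1.
  by move: g1; rewrite mulg1 => ->; rewrite act1.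
exists (inN psi @` A); first exact: finite_image.
move=> _ [m nm <-]; have [a Aa [h Hh <-]] := sA _ nm.
exists (inN psi a); first by exists a.
by exists (inN psi h); [exists h | rewrite inNM].
Qed.

(** * Extension by zero of Hecke algebras *)

Lemma extend_inN {R : realType} {N G : groupType} (psi : aut_action G N)
    (f : N -> R[i]) (n : N) : extend_by_zero (psi := psi) f (inN psi n) = f n.
Proof. by rewrite /extend_by_zero eqxx. Qed.

Lemma extend_out {R : realType} {N G : groupType} (psi : aut_action G N)
    (f : N -> R[i]) (x : semidirect psi) :
  x.2 != 1 -> extend_by_zero f x = 0%R.
Proof. by rewrite /extend_by_zero => /negbTE ->. Qed.

Lemma semidirect_inN {N G : groupType} (psi : aut_action G N)
    (x : semidirect psi) : x.2 = 1 -> x = inN psi x.1.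
Proof. by case: x => n g /= ->. Qed.

Lemma extend_hecke_algebra {R : realType} {N G : groupType}
    (psi : aut_action G N) (H : set N) (f : N -> R[i]) :
  hecke_algebra H f ->
  hecke_algebra (inN psi @` H) (extend_by_zero (psi := psi) f).
Proof.
move=> [bf ff]; split=> [_ _ x [h Hh <-] [k Hk <-]|].
  have [x1|x1] := eqVneq x.2 1.
    by rewrite (semidirect_inN x1) -!inNM !extend_inN bf.
  by rewrite !extend_out //= mul1g mulg1.
apply: (@sub_finite_set _ _ ([set inN psi @` D | D in
    [set double_coset H x | x in [set x | f x != 0%R]]]));
  last exact: finite_image.
move=> _ [x /= fx <-]; have [x1|x1] := eqVneq x.2 1; last first.
  by rewrite extend_out ?eqxx in fx.
rewrite (semidirect_inN x1) extend_inN in fx.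
exists (double_coset H x.1); first by exists x.1.
by rewrite -double_coset_inN -semidirect_inN.
Qed.

(** For [z = h y], right invariance of [f] absorbs the [h^-1] in
    [x z^-1 = x y^-1 h^-1] and left invariance of [g] absorbs [h]: the summands of
    a Hecke product are functions of the coset. *)
Lemma hecke_summand_rep {R : realType} {T : groupType} (H : set T)
    (f g : T -> R[i]) (x y z : T) :
  group_closed [in H] -> hecke_algebra H f -> hecke_algebra H g ->
  right_coset H y z ->
  (f (x * z^-1)%g * g z = f (x * y^-1)%g * g y)%R.
Proof.
move=> gH [bf _] [bg _] [h Hh <-]; congr (_ * _)%R.
  have := bf 1 h^-1 (x * y^-1) (subgroup1 gH) (subgroupV gH Hh).
  by rewrite mul1g invgM mulgA.
have := bg h 1 y Hh (subgroup1 gH); by rewrite mulg1.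
Qed.

(** At a point of [N], the map sending a right coset of [H] in [N] to its image
    under [inN] preserves the summands and is a bijection onto the right cosets
    of [inN H] that lie in [N]; the summands at all other cosets vanish. *)
Lemma extend_hecke_mul {R : realType} {N G : groupType}
    (psi : aut_action G N) (H : set N) (f g : N -> R[i]) :
  group_closed [in H] -> hecke_algebra H f -> hecke_algebra H g ->
  extend_by_zero (psi := psi) (hecke_mul H f g) =
  hecke_mul (inN psi @` H) (extend_by_zero f) (extend_by_zero g).
Proof.
move=> gH Hf Hg; have gK := group_closed_inN psi gH.
have Kf := extend_hecke_algebra psi Hf; have Kg := extend_hecke_algebra psi Hg.
pose F x (c : set (semidirect psi)) := (extend_by_zero f
  (x * (xget 1 c)^-1)%g * extend_by_zero g (xget 1%g c))%R.
have FE x y : F x (right_coset (inN psi @` H) y) =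
    (extend_by_zero f (x * y^-1)%g * extend_by_zero g y)%R.
  exact: hecke_summand_rep gK Kf Kg (right_coset_xget y gK).
apply/funext => x; have [x1|x1] := eqVneq x.2 1; last first.
  (* [x] is outside [N], so [y] and [x * y^-1] are not both in [N]. *)
  rewrite extend_out //; apply/esym/fsbig1 => _ [y _ <-].
  rewrite -[LHS]/(F x _) FE.
  have [y1|y1] := eqVneq y.2 1; last by rewrite (extend_out _ y1) mulr0.
  by rewrite extend_out ?mul0r //= y1 invg1 mulg1.
rewrite (semidirect_inN x1) extend_inN; set n := x.1.
transitivity (\sum_(c \in (fun c => inN psi @` c) @` right_cosets H setT)
                F (inN psi n) c)%R.
  rewrite (fsbig_image _ (fun c => inN psi @` c)); last first.
    by move=> c d _ _; apply/inj_image/inN_inj.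
  apply: eq_fsbigr => _ /set_mem[m _ <-].
  (* The chosen representative of [inN H * inN m] need not be the image of
     the one of [H m]: compare both with [m]. *)
  rewrite -right_coset_inN FE.
  rewrite (hecke_summand_rep _ gH Hf Hg (right_coset_xget m gH)).
  by rewrite -inNV -inNM !extend_inN.
apply: fsbig_widen => [_ [_ [m _ <-] <-]|_ [[y _ <-] yN]].
  by rewrite -right_coset_inN; exists (inN psi m).
rewrite /= FE [X in (_ * X)%R]extend_out ?mulr0 //.
apply: contra_notN yN => /eqP y1.
exists (right_coset H y.1); first by exists y.1.
by rewrite -right_coset_inN -semidirect_inN.
Qed.

Lemma extend_hecke_embedding {R : realType} {N G : groupType}
    (psi : aut_action G N) (H : set N) :
  group_closed [in H] ->
  hecke_embedding H (inN psi @` H) (@extend_by_zero R N G psi).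
Proof.
move=> gH; split.
- by move=> f; exact: extend_hecke_algebra.
- move=> f g _ _ fg; apply/funext => n.
  by rewrite -(extend_inN psi f) fg extend_inN.
- move=> f g _ _ a; apply/funext => x; rewrite /extend_by_zero /=.
  by case: ifP => // _; rewrite mulr0 addr0.
- by move=> f g /set_mem Hf /set_mem Hg; exact: extend_hecke_mul.
split=> [f _|]; apply/funext => x.
  rewrite /hecke_star; have [x1|x1] := eqVneq x.2 1.
    by rewrite (semidirect_inN x1) -inNV !extend_inN.
  by rewrite !extend_out ?rmorph0 //= invg_eq1.
rewrite /hecke_one; have [x1|x1] := eqVneq x.2 1.
  rewrite (semidirect_inN x1) extend_inN; congr (_%:R)%R; congr nat_of_bool.
  by apply/idP/idP => /set_mem; [move=> Hx; apply/mem_set; exists x.1|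
    move=> [n Hn /inN_inj <-]; apply/mem_set].
rewrite extend_out // memNset // => -[n _ nx].
by move: x1; rewrite -nx eqxx.
Qed.

(** * Hecke pairs in a semidirect product *)

Theorem proposition1p7 (R : realType) (N G : groupType) (psi : aut_action G N)
    (N0 : set N) (S : set G) (Gamma0 : set (semidirect psi)) :
  group_closed [in N0] ->
  Gamma0 = inN psi @` N0 ->
  mulg_closed [in S] ->
  [set t^-1 * s | t in S & s in S] = [set: G] ->
  (forall s, S s -> conj_set Gamma0 (inG psi s) `<=` Gamma0) ->
  [/\ hecke_pair Gamma0 <->
        hecke_pair N0 /\
        (forall s, S s ->
           finite_set (right_cosets (conj_set Gamma0 (inG psi s)) Gamma0)),
      forall s, S s ->
        R_cosets Gamma0 (inG psi s)
          #= right_cosets (conj_set Gamma0 (inG psi s)) Gamma0 &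
      hecke_pair N0 -> hecke_pair Gamma0 ->
        hecke_embedding N0 Gamma0 (@extend_by_zero R N G psi)].
Proof.
move=> gN -> _ SS conjS; have gK := group_closed_inN psi gN.
have R_finite s : finite_set (R_cosets (inN psi @` N0) (inG psi s)) <->
    finite_set (right_cosets (conj_set (inN psi @` N0) (inG psi s))
                             (inN psi @` N0)).
  by rewrite (eq_finite_set (card_R_cosets _ gK)).
split=> [|s _|_ _]; [|exact: card_R_cosets|exact: extend_hecke_embedding].
rewrite !hecke_pairE //; split=> [lK|[lN fS] [n g]].
  split=> [n|s _]; first exact/left_finite_inN/lK.
  exact/R_finite/left_finiteV/lK.
have [t St [s Ss ts]] : [set t^-1 * s | t in S & s in S] g by rewrite SS.
have -> : (n, g) = inN psi n * (inG psi t)^-1 * inG psi s.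
  congr pair; last by rewrite /= mul1g.
  by rewrite /= invg1 !act_one !mulg1.
apply: left_finiteM => //; last exact/left_finite_conj_sub/conjS.
apply: left_finiteM => //; first exact/left_finite_inN/lN.
exact/left_finiteV/R_finite/fS.
Qed.
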